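(* Let $k\ge 2$. For every oriented word $u$ of rank $k$, the weight $\tau_u:F_k\to\mathbb{R}$ is a quasi-character of defect $1/2$. Moreover, for all $g,h\in F_k$, $$|\tau_u(g)+\tau_u(h)-\tau_u(gh)|=\begin{cases}0, & \text{if } g=e \text{ or } h=e \text{ or } gh=e,\\ \tfrac12, & \text{if } g\ne e,\ h\neq e \text{ and } gh\ne e.\end{cases}$$
   Context: Let $k\ge 2$ and let $\mathcal{A}=\{a_1,\dots,a_k\}$ be a basis of the free group $F_k$. For $a\in\mathcal{A}$ the inverse is denoted by the corresponding uppercase letter ($A=a^{-1}$, $B=b^{-1}$, $A_i=a_i^{-1}$). Letters in $\mathcal{A}$ are called positive (lowercase), letters in $\mathcal{A}^{-1}$ negative (uppercase), and $\mathcal{A}^{\pm}=\mathcal{A}\cup\mathcal{A}^{-1}$. Elements of $F_k$ are identified with reduced group words over $\mathcal{A}^\pm$; $e$ is the trivial element. An oriented word of rank $k$ is a word of length $2k$ over $\mathcal{A}^\pm$ containing each letter of $\mathcal{A}^\pm$ exactly once. For distinct $x,y\in\mathcal{A}^\pm$, ''$x..y$ in $u$'' means that $x$ is to the left of $y$ in $u$. $\#_w(g)$ is the number of (possibly overlapping) occurrences of $w$ as a contiguous subword of $g$. For an oriented word $u$ of rank $k$ and a reduced word $g$, define $$\alpha_u(g)=\sum_{a,b\in\mathcal{A},\ A..B\text{ in }u}\#_{aB}(g)-\sum_{a,b\in\mathcal{A},\ a..b\text{ in }u}\#_{Ba}(g),$$ $$\beta_u(g)=\sum_{a,b\in\mathcal{A},\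 A..b\text{ in }u}\#_{ab}(g)-\sum_{a,b\in\mathcal{A},\ A..b\text{ in }u}\#_{BA}(g)$$ (sums over ordered pairs $(a,b)$; in $\beta_u$ the case $a=b$ is allowed), and let $\omega(g)=\frac12$ if the last letter of $g$ is in $\mathcal{A}$, $\omega(g)=-\frac12$ if it is in $\mathcal{A}^{-1}$, $\omega(e)=0$. The weight induced by $u$ is $\tau_u=\alpha_u+\beta_u+\omega$ (always evaluated on reduced forms). A quasi-character of a group $G$ is a function $\varphi:G\to\mathbb{R}$ for which there is a constant $D$ with $|\varphi(g)+\varphi(h)-\varphi(gh)|\le D$ for all $g,h\in G$; its defect is $\delta(\varphi)=\sup_{g,h\in G}|\varphi(g)+\varphi(h)-\varphi(gh)|$. *)

(* Defs.v *)
From HB Require Import structures.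
From mathcomp Require Import all_boot all_order all_algebra.
From mathcomp Require Import boolp classical_sets reals.

Set Implicit Arguments.
Unset Strict Implicit.
Unset Printing Implicit Defensive.

Import Order.TTheory GRing.Theory Num.Theory.
Local Open Scope ring_scope.

(* The alphabet {a_i, A_i | i < k}: (i, true) is the positive letter a_i and
   (i, false) is its inverse A_i. *)
Definition letter (k : nat) : Type := ('I_k * bool)%type.
HB.instance Definition _ (k : nat) := Finite.on (letter k).

Definition pos (k : nat) (i : 'I_k) : letter k := (i, true).
Definition neg (k : nat) (i : 'I_k) : letter k := (i, false).
Definition linv (k : nat) (x : letter k) : letter k := (x.1, ~~ x.2).

Lemma linvK (k : nat) : involutive (@linv k).
Proof. by case=> i b; rewrite /linv /= negbK. Qed.

Definition reduced (k : nat) (w : seq (letter k)) : bool :=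
  sorted (fun x y => y != linv x) w.

Definition cons_red (k : nat) (x : letter k) (w : seq (letter k)) :
    seq (letter k) :=
  if w is y :: w' then if y == linv x then w' else x :: w else [:: x].

(* Free reduction. *)
Definition reduce (k : nat) (w : seq (letter k)) : seq (letter k) :=
  foldr (@cons_red k) [::] w.

Definition winv (k : nat) (w : seq (letter k)) : seq (letter k) :=
  rev (map (@linv k) w).

Section FreeReduction.
Variable k : nat.
Implicit Types (x y : letter k) (v w s t : seq (letter k)).

Lemma reduced_tl x w : reduced (x :: w) -> reduced w.
Proof. exact: path_sorted. Qed.

Lemma cons_red_reduced x w : reduced w -> reduced (cons_red x w).
Proof.
case: w => [|y w] //= rw; case: ifPn => [_|ny]; first exact: reduced_tl rw.
by rewrite /reduced /= ny.
Qed.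

Lemma foldr_reduced s w : reduced w -> reduced (foldr (@cons_red k) w s).
Proof. by move=> rw; elim: s => //= x s IH; apply: cons_red_reduced. Qed.

Lemma reduce_reduced w : reduced (reduce w).
Proof. exact: foldr_reduced. Qed.

Lemma reduce_id w : reduced w -> reduce w = w.
Proof.
elim: w => //= x w IH rxw; rewrite -/(reduce w) IH ?(reduced_tl rxw) //.
by case: w rxw {IH} => //= y w /andP[/negPf->].
Qed.

Lemma cons_redK x w : reduced w -> cons_red x (cons_red (linv x) w) = w.
Proof.
case: w => [|y w] /=; first by rewrite eqxx.
rewrite linvK; case: eqP => [->|_] /=; last by rewrite eqxx.
by case: w => //= z w /andP[/negPf->].
Qed.

Lemma foldr_reduce s w :
  reduced w -> foldr (@cons_red k) w (reduce s) = foldr (@cons_red k) w s.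
Proof.
move=> rw; elim: s => //= x s <-; rewrite -/(reduce s).
case: (reduce s) => //= y t; case: eqP => //= ->.
by rewrite cons_redK //; apply: foldr_reduced.
Qed.

Lemma reduce_cat s t : reduce (s ++ t) = foldr (@cons_red k) (reduce t) s.
Proof. by rewrite /reduce foldr_cat. Qed.

Lemma reduce_catl s t : reduce (reduce s ++ t) = reduce (s ++ t).
Proof. by rewrite !reduce_cat foldr_reduce // reduce_reduced. Qed.

Lemma reduce_catr s t : reduce (s ++ reduce t) = reduce (s ++ t).
Proof. by rewrite !reduce_cat (reduce_id (reduce_reduced t)). Qed.

Lemma reduce_winvr w : reduce (w ++ winv w) = [::].
Proof.
rewrite /winv; elim: w => //= x w IH.
rewrite rev_cons -cats1 catA -/(reduce _) -reduce_catl IH /=.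
by rewrite eqxx.
Qed.

Lemma winvK : involutive (@winv k).
Proof. by move=> w; rewrite /winv map_rev revK -map_comp map_id_in // => x _; exact: linvK. Qed.

Lemma reduce_winvl w : reduce (winv w ++ w) = [::].
Proof. by rewrite -{2}(winvK w) reduce_winvr. Qed.

Lemma winv_reduced w : reduced w -> reduced (winv w).
Proof.
rewrite /reduced /winv rev_sorted sorted_map; apply: sub_sorted => x y /=.
by rewrite linvK; apply: contra_neq => ->.
Qed.

End FreeReduction.

(* The free group F_k on the letters a_0, ..., a_(k-1), realised as the set of
   reduced words, with concatenation followed by free reduction as product. *)
Record freegroup (k : nat) : Type := FreeGroup {
  word_of :> seq (letter k);
  word_of_reduced : reduced word_of
}.

HB.instance Definition _ (k : nat) := [isSub for @word_of k].
HB.instance Definition _ (k : nat) := [Choice of freegroup k by <:].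

Definition fg_one (k : nat) : freegroup k := @FreeGroup k [::] isT.
Definition fg_mul (k : nat) (g h : freegroup k) : freegroup k :=
  FreeGroup (reduce_reduced (g ++ h)).
Definition fg_inv (k : nat) (g : freegroup k) : freegroup k :=
  FreeGroup (winv_reduced (word_of_reduced g)).

Lemma fg_mulA (k : nat) : associative (@fg_mul k).
Proof.
by move=> f g h; apply: val_inj; rewrite /= reduce_catl reduce_catr catA.
Qed.

Lemma fg_mul1g (k : nat) : left_id (@fg_one k) (@fg_mul k).
Proof. by case=> w rw; apply: val_inj; rewrite /= reduce_id. Qed.

Lemma fg_mulg1 (k : nat) : right_id (@fg_one k) (@fg_mul k).
Proof. by case=> w rw; apply: val_inj; rewrite /= cats0 reduce_id. Qed.

Lemma fg_mulVg (k : nat) : left_inverse (@fg_one k) (@fg_inv k) (@fg_mul k).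
Proof. by move=> g; apply: val_inj; rewrite /= reduce_winvl. Qed.

Lemma fg_mulgV (k : nat) : right_inverse (@fg_one k) (@fg_inv k) (@fg_mul k).
Proof. by move=> g; apply: val_inj; rewrite /= reduce_winvr. Qed.

HB.instance Definition _ (k : nat) := isGroup.Build (freegroup k)
  (@fg_mulA k) (@fg_mul1g k) (@fg_mulg1 k) (@fg_mulVg k) (@fg_mulgV k).

Definition oriented_word (k : nat) (u : seq (letter k)) : bool :=
  (size u == 2 * k)%N && [forall x : letter k, count_mem x u == 1%N].

(* x..y in u; meant for letters x, y that each occur exactly once in u *)
Definition before (k : nat) (u : seq (letter k)) (x y : letter k) : bool :=
  (index x u < index y u)%N.

(* Number of positions of g at which the nonempty word w occurs contiguously. *)
Definition occ (k : nat) (w g : seq (letter k)) : nat :=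
  (\sum_(i < size g) prefix w (drop i g))%N.

Section Weight.
Variables (R : realType) (k : nat) (u : seq (letter k)).

Definition alpha (g : seq (letter k)) : R :=
  \sum_(a < k) \sum_(b < k | before u (neg a) (neg b))
      (occ [:: pos a; neg b] g)%:R
  - \sum_(a < k) \sum_(b < k | before u (pos a) (pos b))
      (occ [:: neg b; pos a] g)%:R.

Definition beta (g : seq (letter k)) : R :=
  \sum_(a < k) \sum_(b < k | before u (neg a) (pos b))
      (occ [:: pos a; pos b] g)%:R
  - \sum_(a < k) \sum_(b < k | before u (neg a) (pos b))
      (occ [:: neg b; neg a] g)%:R.

Definition omega (g : seq (letter k)) : R :=
  if g is x :: s then (if (last x s).2 then 1 / 2 else - (1 / 2)) else 0.

Definition tau (g : freegroup k) : R := alpha g + beta g + omega g.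

End Weight.

Section QuasiCharacter.
Variables (R : realType) (G : groupType) (phi : G -> R).

Definition quasi_character : Prop :=
  exists D : R, forall g h : G, `|phi g + phi h - phi (g * h)%g| <= D.

(* [sup] takes the value 0 on unbounded sets, so the defect is only meaningful
   for quasi-characters. *)
Definition defect : R :=
  sup [set r : R | exists g h : G, r = `|phi g + phi h - phi (g * h)%g|].

End QuasiCharacter.

(* Main.v *)
Require Import Defs.
From HB Require Import structures.
From mathcomp Require Import all_boot all_order all_algebra.
From mathcomp Require Import boolp classical_sets reals.
From mathcomp Require Import ring lra.
Import Order.TTheory GRing.Theory Num.Theory.
Local Open Scope ring_scope.

Set Implicit Arguments.
Unset Strict Implicit.
Unset Printing Implicit Defensive.

(** The weight of a reduced word [g] is a sum, over its pairs of consecutive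
    letters [x y], of a number depending on [x] and [y] only, plus the final
    correction [omega].  Running through the four sign patterns shows that the
    number attached to [x y] is always

      sign x + order (x^-1, y),

    where [sign] is 1/2 on positive and -1/2 on negative letters, and where
    [order (s, t)] is 1/2 if [s] precedes [t] in the oriented word, -1/2 if [t]
    precedes [s].  Since [omega] supplies the sign of the last letter,

      tau = height + turning   ([weight_height_turning]),

    where [height] sums the signs of all letters and is a homomorphism, and
    [turning] sums [order (x^-1, y)] over the consecutive pairs.  Think of [g]
    as a path in the Cayley tree: at each inner vertex [x^-1] and [y] are the
    two directions in which the path leaves this vertex, and [turning] records
    which comes first.  As [order] is antisymmetric, reversing the path changes
    the sign of [turning].

    Now write [g = p c] and [h = c^-1 q] with [gh = p q] reduced
    ([cancellation]).  The paths of [g], [h] and [gh] are the sides of a tripod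
    with legs [p^-1], [c] and [q].  In the defect everything cancels along the
    legs, and what remains is the contribution of the centre
    ([turning_tripod],
    [order_cocycle]):

      order (p^-1, c) + order (c, q) - order (p^-1, q),

    evaluated at first letters, a term with an empty leg being zero.  If no leg
    is empty, the three letters are distinct and for a linear order this sum is
    1/2 or -1/2; with one empty leg a single term is left, and with two empty
    legs nothing is.  The legs [p] and [c] are both empty exactly if [g] is
    trivial, and similarly for [h] and [gh]. *)

Section Words.
Variable k : nat.
Implicit Types (x y : letter k) (g h p c q s t : seq (letter k)).

(** * Cancellation in a product of reduced words *)

Lemma winv_cons x s : winv (x :: s) = rcons (winv s) (linv x).
Proof. by rewrite /winv /= rev_cons. Qed.

Lemma winv_rcons s x : winv (rcons s x) = linv x :: winv s.
Proof. by rewrite /winv map_rcons rev_rcons. Qed.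

(** Two paths that start at the same vertex of the Cayley tree leave it along
    different edges; an empty path diverges from every path. *)
Definition diverge s t : bool :=
  if s is x :: _ then if t is y :: _ then x != y else true else true.

(** Reducedness concerns neighbours only: at the seam it says that the path
    does not turn back. *)
Lemma reduced_cat p q :
  reduced (p ++ q) = [&& reduced p, reduced q & diverge (winv p) q].
Proof.
elim: p => [|x p IH]; first by rewrite /= andbT.
case: p IH => [|y p] IH.
  by case: q {IH} => [|y q] //=; rewrite /reduced /= eq_sym andbC.
have -> : reduced ((x :: y :: p) ++ q) = (y != linv x) && reduced ((y :: p) ++ q).
  by rewrite /reduced.
rewrite IH !winv_cons; case: (winv p) => [|z r] /=;
 by rewrite /reduced /= -!andbA.
Qed.

(** Strip matching letters from the end of [g] and the beginning of [h] until
    the two paths from the end of [g] diverge; [c] collects what was stripped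
    from [g]. *)
Lemma cancellation g h : reduced g -> reduced h ->
  exists p c q, [/\ g = p ++ c, h = winv c ++ q & reduced (p ++ q)].
Proof.
elim/last_ind: g h => [|g x IH] h rg rh; first by exists [::], [::], h.
have rg' : reduced g by move: rg; rewrite -cats1 reduced_cat => /andP[].
case: (boolP (diverge (winv (rcons g x)) h)) => [d|].
  by exists (rcons g x), [::], h; rewrite cats0 reduced_cat rg rh d.
rewrite winv_rcons; case: h rh => //= y h rh; rewrite negbK => /eqP yE.
rewrite -{y}yE in rh *.
have [p [c [q [-> -> r]]]] := IH h rg' (reduced_tl rh).
by exists p, (rcons c x), q; rewrite winv_rcons rcons_cat.
Qed.

Lemma reduce_cancel p c q : reduced (p ++ q) ->
  reduce ((p ++ c) ++ winv c ++ q) = p ++ q.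
Proof.
move=> r; rewrite -catA -reduce_catr (catA c) -(reduce_catl (c ++ _)).
by rewrite reduce_winvr reduce_catr reduce_id.
Qed.

End Words.

Section Weight.
Variables (R : realType) (k : nat) (u : seq (letter k)).
Implicit Types (x y z : letter k) (g h p c q s t : seq (letter k)).

(** * The weight as the sum of a homomorphism and an antisymmetric part *)

Definition sign x : R := if x.2 then 1 / 2 else - (1 / 2).

Definition height g : R := \sum_(x <- g) sign x.

(** The symmetric form makes the order antisymmetric on all pairs of letters,
    with value 0 on equal ones, so that reversing a path changes the sign of
    its turning even if the path is not reduced. *)
Definition order x y : R := ((before u x y)%:R - (before u y x)%:R) / 2.

(** Compares two paths leaving a common vertex by their first edges; the value
    0 for an empty path makes the formulas below uniform in degenerate cases. *)
Definition order_heads s t : R :=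
  if s is x :: _ then if t is y :: _ then order x y else 0 else 0.

(** The reversed letter [linv x] is the direction in which the path came to the
    vertex that it leaves along the head of [s]. *)
Fixpoint turning g : R :=
  if g is x :: s then order_heads [:: linv x] s + turning s else 0.

Lemma orderC x y : order x y = - order y x.
Proof. by rewrite /order; lra. Qed.

Lemma order_headsC s t : order_heads s t = - order_heads t s.
Proof. by case: s t => [|x s] [|y t] /=; rewrite ?oppr0 // orderC. Qed.

Lemma height_cat p q : height (p ++ q) = height p + height q.
Proof. exact: big_cat. Qed.

Lemma height_winv g : height (winv g) = - height g.
Proof.
rewrite /height /winv (perm_big _ (permEl (perm_rev _))) big_map -sumrN.
by apply: eq_bigr => -[i []] _; rewrite /sign /= ?opprK.
Qed.

Lemma turning_cat p q :
  turning (p ++ q) = turning p + turning q + order_heads (winv p) q.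
Proof.
elim: p => [|x p IH] /=; first by rewrite add0r addr0.
rewrite {}IH winv_cons; case: p => [|y p] /=; first by ring.
by rewrite winv_cons; case: (winv p) => [|z r] /=; ring.
Qed.

Lemma turning_winv g : turning (winv g) = - turning g.
Proof.
elim: g => [|x g IH] /=; first by rewrite oppr0.
rewrite winv_cons -cats1 turning_cat IH winvK /= order_headsC /=; ring.
Qed.

(** Each leg of the tripod is run through by two of the three sides.  The legs
    [p] and [q] occur with opposite signs because [turning (p ++ q)] is
    subtracted, the leg [c] because it is run through in both directions. *)
Lemma turning_tripod p c q :
  turning (p ++ c) + turning (winv c ++ q) - turning (p ++ q) =
  order_heads (winv p) c + order_heads c q - order_heads (winv p) q.
Proof. by rewrite !turning_cat turning_winv winvK; ring. Qed.

Lemma occ2_cons2 (a b : letter k) x y g :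
  occ [:: a; b] [:: x, y & g] =
  (((a == x) && (b == y)) + occ [:: a; b] (y :: g))%N.
Proof. by rewrite /occ big_ord_recl /= prefix0s andbT. Qed.

Lemma occ2_1 (a b : letter k) x : occ [:: a; b] [:: x] = 0%N.
Proof. by rewrite /occ big_ord1 /= andbF. Qed.

Lemma sum_occ2_cons2 (d e : bool) (P : 'I_k -> 'I_k -> bool) x y g :
  \sum_(a < k) \sum_(b < k | P a b) (occ [:: (a, d); (b, e)] [:: x, y & g])%:R
  = ([&& d == x.2, e == y.2 & P x.1 y.1])%:R
    + \sum_(a < k) \sum_(b < k | P a b) (occ [:: (a, d); (b, e)] (y :: g))%:R
  :> R.
Proof.
case: x y => [i d'] [j e'] /=.
under eq_bigr => a _.
  under eq_bigr => b _ do rewrite occ2_cons2 natrD.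
  rewrite big_split /=; over.
rewrite big_split /=; congr (_ + _).
rewrite (bigD1 i) //= [X in _ + X]big1 ?addr0 => [|a /negPf ai]; last first.
  by rewrite big1 // => b _; rewrite xpair_eqE ai.
rewrite big_mkcond (bigD1 j) //= big1 ?addr0 => [|b /negPf bj]; last first.
  by rewrite !xpair_eqE bj andbF; case: (P i b).
by rewrite !xpair_eqE !eqxx; case: (P i j); rewrite ?andbT ?andbF.
Qed.

Lemma sum_occ2_1 (d e : bool) (P : 'I_k -> 'I_k -> bool) x :
  \sum_(a < k) \sum_(b < k | P a b) (occ [:: (a, d); (b, e)] [:: x])%:R
  = 0 :> R.
Proof. by rewrite big1 // => a _; rewrite big1 // => b _; rewrite occ2_1. Qed.

(** In two of the four sums the pair [(a, b)] indexes the word with [b] first;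
    exchanging the summations brings them to the shape of the other two. *)
Lemma sum_swap (P : 'I_k -> 'I_k -> bool) (F : 'I_k -> 'I_k -> R) :
  \sum_(a < k) \sum_(b < k | P a b) F b a =
  \sum_(a < k) \sum_(b < k | P b a) F a b.
Proof. exact: exchange_big_dep. Qed.

Lemma before_total x y :
  oriented_word u -> x != y -> before u x y = ~~ before u y x.
Proof.
move=> /andP[_ /forallP u1] xy; rewrite /before -leqNgt ltn_neqAle.
suff -> : index x u != index y u by [].
have in_u z : z \in u by rewrite -has_pred1 has_count (eqP (u1 z)).
by apply: contra xy => /eqP eqxy; apply/eqP; exact: index_inj eqxy.
Qed.

Definition weight g : R := alpha R u g + beta R u g + omega R g.

(** A pair [x y] with [x] positive contributes 1 if [x^-1] precedes [y] and 0
    otherwise, which is 1/2 more than [order x^-1 y].  If [x] is negative, it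
    contributes -1 if [y] precedes [x^-1] and 0 otherwise, which is 1/2 less.
    Reducedness enters here: [x^-1] and [y] must be distinct to be ordered. *)
Lemma weight_cons2 x y g : oriented_word u -> y != linv x ->
  weight [:: x, y & g] = sign x + order (linv x) y + weight (y :: g).
Proof.
move=> hu yx; rewrite /weight /alpha /beta.
rewrite ![\sum_(a < k) \sum_(b < k | _) (occ [:: neg b; _ a] _)%:R]sum_swap.
rewrite !sum_occ2_cons2 /sign /order; have := before_total hu yx.
case: x y {yx} => [i []] [j []]; rewrite /pos /neg /linv /= => ->;
  case: (before u (i, _) (j, _)) => /=; lra.
Qed.

Lemma weight_height_turning g : oriented_word u -> reduced g ->
  weight g = height g + turning g.
Proof.
move=> hu; elim: g => [|x [|y g] IH] r.
- rewrite /weight /alpha /beta /height big_nil /=.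
  by rewrite !big1 ?subr0 ?addr0 // => a _; rewrite big1 // => b _;
     rewrite /occ big_ord0.
- rewrite /weight /alpha /beta.
  rewrite ![\sum_(a < k) \sum_(b < k | _) (occ [:: neg b; _ a] _)%:R]sum_swap.
  by rewrite !sum_occ2_1 /height big_seq1 /= /sign subrr !add0r !addr0.
have yx : y != linv x by case/andP: r.
rewrite weight_cons2 // IH ?(reduced_tl r) // /height [in RHS]big_cons /=; ring.
Qed.

(** * The contribution of the centre of the tripod *)

Lemma normr_half (v : R) : v = 1 / 2 \/ v = - (1 / 2) -> `|v| = 1 / 2.
Proof. by case=> ->; rewrite ?normrN ger0_norm //; lra. Qed.

Lemma order_cases x y : oriented_word u -> x != y ->
  order x y = 1 / 2 \/ order x y = - (1 / 2).
Proof.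
move=> hu xy; rewrite /order (before_total hu xy).
by case: before => /=; [right|left]; lra.
Qed.

(** By transitivity, [order x y], [order y z] and [order z x] do not all have
    the same sign; so two of them cancel and the third one remains. *)
Lemma order_cocycle x y z : oriented_word u ->
  x != y -> y != z -> x != z ->
  `|order x y + order y z - order x z| = 1 / 2.
Proof.
move=> hu xy yz xz.
have zyx : before u z y -> before u y x -> before u z x by apply: ltn_trans.
have xyz : before u x y -> before u y z -> before u x z by apply: ltn_trans.
move: xyz zyx; rewrite /order.
rewrite (before_total hu xy) (before_total hu yz) (before_total hu xz).
case: (before u y x) (before u z y) (before u z x) => [] [] [] /= xyz zyx;
  try by [have := xyz isT isT | have := zyx isT isT].
all: by apply: normr_half; (left; lra) || (right; lra).
Qed.

(** With one empty leg a single term of the sum is left, which is nonzero since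
    the other two legs diverge; with two empty legs all terms vanish. *)
Lemma order_heads_tripod s t r : oriented_word u ->
  diverge s t -> diverge t r -> diverge s r ->
  `|order_heads s t + order_heads t r - order_heads s r| =
  if [|| nilp s && nilp t, nilp t && nilp r | nilp s && nilp r]
  then 0 else 1 / 2.
Proof.
move=> hu; case: s t r => [|x s] [|y t] [|z r] //= st tr sr;
  rewrite ?subr0 ?subrr ?addr0 ?add0r ?sub0r ?oppr0 ?normr0 ?normrN //;
  first [exact: order_cocycle | apply: normr_half; exact: order_cases].
Qed.

Lemma nilp_winv s : nilp (winv s) = nilp s.
Proof. by rewrite /nilp size_rev size_map. Qed.

Lemma tau_defect (g h : freegroup k) : oriented_word u ->
  `|tau R u g + tau R u h - tau R u (g * h)%g| =
  if [|| g == 1%g, h == 1%g | (g * h)%g == 1%g] then 0 else 1 / 2.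
Proof.
move=> hu; have eq1 (f : freegroup k) : (f == 1%g) = nilp (word_of f).
  by rewrite -val_eqE /=; case: (word_of f).
have tauE (f : freegroup k) : tau R u f = height f + turning f.
  exact: weight_height_turning hu (word_of_reduced f).
have [p [c [q [gE hE r]]]] := cancellation (word_of_reduced g) (word_of_reduced h).
have ghE : word_of (g * h)%g = p ++ q by rewrite /= gE hE reduce_cancel.
have := word_of_reduced g; have := word_of_reduced h.
rewrite !eq1 !tauE ghE gE hE !cat_nilp nilp_winv !height_cat height_winv.
move: r; rewrite !reduced_cat winvK => /and3P[_ _ pq] /and3P[_ _ cq] /and3P[_ _ pc].
(* The heights cancel, and the turnings leave the centre of the tripod. *)
have := order_heads_tripod hu pc cq pq.
rewrite nilp_winv -turning_tripod => <-; congr (`|_|); ring.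
Qed.

End Weight.

Theorem theorem1 (R : realType) (k : nat) (hk : (2 <= k)%N)
    (u : seq (letter k)) (hu : oriented_word u) :
  quasi_character (tau R u) /\
  defect (tau R u) = 1 / 2 /\
  (forall g h : freegroup k,
     `|tau R u g + tau R u h - tau R u (g * h)%g| =
     if [|| g == 1%g, h == 1%g | (g * h)%g == 1%g] then 0 else 1 / 2).
Proof.
have le_half g h : `|tau R u g + tau R u h - tau R u (g * h)%g| <= 1 / 2.
  by rewrite tau_defect //; case: ifP => _; lra.
split; first by exists (1 / 2).
split; last by move=> g h; exact: tau_defect.
pose a : freegroup k := @FreeGroup k [:: pos (Ordinal (ltnW hk))] isT.
(* The supremum is attained: [a], [a] and [a a] are nontrivial. *)
have attained : 1 / 2 = `|tau R u a + tau R u a - tau R u (a * a)%g|.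
  by rewrite tau_defect.
apply/le_anti/andP; split.
  by apply: ge_sup => [|_ [g [h ->]]]; [exists (1 / 2), a, a | exact: le_half].
apply: ub_le_sup; last by exists a, a.
by exists (1 / 2) => _ [g [h ->]]; exact: le_half.
Qed.
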